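(* Let $N\ge1$, $\delta>0$, $\alpha>0$. Suppose each $c_n:\mathbb{R}\to\mathbb{R}$ ($n=1,\dots,N$) is continuous, satisfies $c_n(s)=0$ for $s\le 0$, is convex and strictly increasing on $[0,\infty)$, and satisfies $\frac{\partial^+c_n(0)}{\partial s_n}\ge\frac{\alpha}{2N}$. Suppose the social cost minimization problem has an optimal solution $(\mathbf{s}^*,y^* )$ with $y^*>0$, with corresponding socially optimal price $p^*$. Let $(p^t,y^t)$ and $(p^a,y^a)$ be the price and on-site generation at the price-taking and at the price-anticipating market equilibrium, respectively. Then the operator's cost for price-anticipating tenants is at most that in the socially optimal case, and moreover $$\mathrm{cost}_o(p^*,y^* )-\frac{\alpha\delta}{N}\le\mathrm{cost}_o(p^a,y^a)\le\mathrm{cost}_o(p^*,y^* ),$$ $$\mathrm{cost}_o(p^a,y^a)-\frac{\alpha\delta}{N}\le\mathrm{cost}_o(p^t,y^t)\le\mathrm{cost}_o(p^a,y^a).$$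
   Context: There are $N$ tenants; $\delta$ is the total energy reduction target; $y$ is the amount of on-site generation, with unit cost $\alpha$. $\partial^+$ denotes right derivative. The operator's cost is $\mathrm{cost}_o(p,y)=p(\delta-y)+\alpha y$. The social cost minimization problem is $$\min\ \alpha y+\sum_{i=1}^N c_i(s_i)\quad\text{s.t.}\quad y+\sum_{i=1}^N s_i=\delta,\ s_i\ge0,\ y\ge0;$$ the socially optimal price $p^*$ is the Lagrange multiplier of the constraint $y+\sum_i s_i=\delta$. Supply function: $S(b_n,p)=\delta-\frac{b_n}{p}$. Clearing price: $p(\mathbf{b},y)=\frac{\sum_n b_n}{(N-1)\delta+y}$ (conventions $0/0=0$, $x/0=+\infty$ for $x>0$). Price-taking payoff: $P_n(b_n;p)=p\delta-b_n-c_n\!\left(\delta-\frac{b_n}{p}\right)$. Price-anticipating payoff (obtained with $p=\sqrt{(\sum_m b_m)\alpha/(N\delta)}$): for $\sum_m b_m>0$, $$Q_n(b_n;\mathbf{b}_{-n})=\sqrt{\frac{(\sum_m b_m)\alpha\delta}{N}}-b_n-c_n\!\left(\delta-\frac{b_n}{\sqrt{\sum_m b_m}}\sqrt{\frac{N\delta}{\alpha}}\right).$$ A price-taking (resp. price-anticipating) market equilibrium is a triple $(\mathbf{b},p,y)$ with $\mathbf{b}\ge0$, $p>0$ such that for all $n$ and all $\bar b_n\ge0$, $P_n(b_n;p)\ge P_n(\bar b_n;p)$ (resp. $Q_n(b_n;\mathbf{b}_{-n})\ge Q_n(\bar b_n;\mathbf{b}_{-n})$ whenever defined); $p=p(\mathbf{b},y)$;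 and $y\in\arg\min_{0\le y'\le\delta}(\delta-y')p(\mathbf{b},y')+\alpha y'$. *)

(* Defs.v *)
From HB Require Import structures.
From mathcomp Require Import all_boot all_order all_algebra.
From mathcomp Require Import all_classical all_reals all_analysis.

Set Implicit Arguments.
Unset Strict Implicit.
Unset Printing Implicit Defensive.

Import Order.TTheory GRing.Theory Num.Theory.
Import numFieldNormedType.Exports.

Local Open Scope classical_set_scope.
Local Open Scope ring_scope.

(* [lim] is total; for a continuous f that is convex and increasing on
   [a, +oo[ the limit exists. *)
Definition right_derivative (R : realType) (f : R -> R) (a : R) : R :=
  lim ((fun h : R => (f (a + h) - f a) / h) @ 0^'+).

Definition cost_o (R : realType) (delta alpha p y : R) : R :=
  p * (delta - y) + alpha * y.

Definition social_cost (R : realType) (N : nat) (alpha : R)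
    (c : 'I_N -> R -> R) (s : 'I_N -> R) (y : R) : R :=
  alpha * y + \sum_(i < N) c i (s i).

Definition social_feasible (R : realType) (N : nat) (delta : R)
    (s : 'I_N -> R) (y : R) : Prop :=
  [/\ y + \sum_(i < N) s i = delta, forall i, 0 <= s i & 0 <= y].

Definition social_optimum (R : realType) (N : nat) (delta alpha : R)
    (c : 'I_N -> R -> R) (s : 'I_N -> R) (y : R) : Prop :=
  social_feasible delta s y /\
  forall (s' : 'I_N -> R) (y' : R), social_feasible delta s' y' ->
    social_cost alpha c s y <= social_cost alpha c s' y'.

Definition social_lagrangian (R : realType) (N : nat) (delta alpha : R)
    (c : 'I_N -> R -> R) (p : R) (s : 'I_N -> R) (y : R) : R :=
  social_cost alpha c s y + p * (delta - (y + \sum_(i < N) s i)).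

(* Only the balance constraint is dualized; the sign constraints on s and y
   stay explicit. *)
Definition socially_optimal_price (R : realType) (N : nat) (delta alpha : R)
    (c : 'I_N -> R -> R) (s : 'I_N -> R) (y p : R) : Prop :=
  forall (s' : 'I_N -> R) (y' : R), (forall i, 0 <= s' i) -> 0 <= y' ->
    social_lagrangian delta alpha c p s y
      <= social_lagrangian delta alpha c p s' y'.

Definition supply (R : realType) (delta b p : R) : R := delta - b / p.

(* The denominator vanishes only for N = 1 and y = 0; then 0/0 = 0 and
   x/0 = +oo for x > 0. *)
Definition clearing_price (R : realType) (N : nat) (delta : R)
    (b : 'I_N -> R) (y : R) : \bar R :=
  let B := \sum_(n < N) b n in
  let D := (N%:R - 1) * delta + y in
  if D == 0 then (if B == 0 then 0%E else +oo%E) else (B / D)%:E.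

Definition operator_objective (R : realType) (N : nat) (delta alpha : R)
    (b : 'I_N -> R) (y : R) : \bar R :=
  ((delta - y)%:E * clearing_price delta b y + (alpha * y)%:E)%E.

Definition operator_optimal (R : realType) (N : nat) (delta alpha : R)
    (b : 'I_N -> R) (y : R) : Prop :=
  0 <= y <= delta /\
  forall y' : R, 0 <= y' <= delta ->
    (operator_objective delta alpha b y
       <= operator_objective delta alpha b y')%E.

Definition price_taking_payoff (R : realType) (N : nat) (delta : R)
    (c : 'I_N -> R -> R) (p : R) (n : 'I_N) (x : R) : R :=
  p * delta - x - c n (supply delta x p).

Definition total_bid (R : realType) (N : nat) (b : 'I_N -> R) (n : 'I_N)
    (x : R) : R :=
  x + \sum_(m < N | m != n) b m.

(* Q_n(x; b_{-n}); the entry b n is not used. Meaningful only when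
   0 < total_bid b n x. *)
Definition price_anticipating_payoff (R : realType) (N : nat)
    (delta alpha : R) (c : 'I_N -> R -> R) (b : 'I_N -> R) (n : 'I_N)
    (x : R) : R :=
  let B := total_bid b n x in
  Num.sqrt (B * alpha * delta / N%:R) - x
  - c n (delta - x / Num.sqrt B * Num.sqrt (N%:R * delta / alpha)).

Definition price_taking_equilibrium (R : realType) (N : nat)
    (delta alpha : R) (c : 'I_N -> R -> R) (b : 'I_N -> R) (p y : R) : Prop :=
  [/\ (forall n, 0 <= b n) /\ 0 < p,
      forall (n : 'I_N) (x : R), 0 <= x ->
        price_taking_payoff delta c p n x
          <= price_taking_payoff delta c p n (b n),
      p%:E = clearing_price delta b y &
      operator_optimal delta alpha b y].

Definition price_anticipating_equilibrium (R : realType) (N : nat)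
    (delta alpha : R) (c : 'I_N -> R -> R) (b : 'I_N -> R) (p y : R) : Prop :=
  [/\ (forall n, 0 <= b n) /\ 0 < p,
      forall (n : 'I_N) (x : R), 0 <= x ->
        0 < total_bid b n (b n) -> 0 < total_bid b n x ->
        price_anticipating_payoff delta alpha c b n x
          <= price_anticipating_payoff delta alpha c b n (b n),
      p%:E = clearing_price delta b y &
      operator_optimal delta alpha b y].

(* Main.v *)
(* Since y* > 0, the socially optimal price is alpha and its cost is alpha delta.
   At any optimal y in ]0, delta] of the operator, the first-order condition
   turns the cost into alpha delta - alpha (delta - y)^2 / (N delta), so
   everything reduces to 0 < yt <= ya. Market clearing says that the supplies
   sum to delta - y. Price-taking tenants have marginal cost pt; the first-order
   condition of anticipating tenants forces their marginal cost strictly above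
   the price they anticipate as soon as they supply something. By convexity, at
   prices below alpha no tenant supplies more than in the social optimum, whence
   y > 0; and ya < yt would make some tenant supply more when anticipating, at a
   lower price. *)

Require Import Defs.
From HB Require Import structures.
From mathcomp Require Import all_boot all_order all_algebra.
From mathcomp Require Import all_classical all_reals all_analysis.
From mathcomp Require Import ring lra.

Import Order.TTheory GRing.Theory Num.Theory.
Import numFieldNormedType.Exports.

Local Open Scope classical_set_scope.
Local Open Scope ring_scope.

(** * Elementary inequalities for perturbation arguments *)

(** Let [t] tend to 0. This stands in for differentiation: once a perturbation inequality is divided
    by its step, the constant term is the first-order condition. *)
Lemma quadratic_le0_at0 (R : realFieldType) (a0 a1 a2 e : R) :
  0 < e -> (forall t, 0 < t <= e -> a0 + a1 * t + a2 * t ^+ 2 <= 0) -> a0 <= 0.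
Proof.
move=> e0 H; rewrite leNgt; apply/negP => a00.
set m := `|a1| + `|a2| + 1.
have m0 : 0 < m by rewrite /m ltr_wpDl// addr_ge0.
(* Since [t <= 1], the two higher terms together are at most [m * t <= a0 / 2] in absolute value. *)
pose t := Num.min (Num.min e 1) (a0 / (2 * m)).
have t0 : 0 < t by rewrite !lt_min e0 ltr01/= divr_gt0// mulr_gt0.
have te : t <= e by rewrite !ge_min lexx.
have t1 : t <= 1 by rewrite !ge_min lexx orbT.
have ta : t * (2 * m) <= a0 by rewrite -ler_pdivlMr ?mulr_gt0// ge_min lexx orbT.
have := H t; rewrite t0 te => /(_ isT).
have h1 : - `|a1| * t <= a1 * t by rewrite ler_pM2r// lerNnormlW.
have h2 : - `|a2| * t ^+ 2 <= a2 * t ^+ 2 by rewrite ler_pM2r ?exprn_gt0// lerNnormlW.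
have h3 : `|a2| * t ^+ 2 <= `|a2| * t.
  by rewrite ler_wpM2l// expr2 ger_pMl.
rewrite /m in ta; nra.
Qed.

(** For a convex function, the slope of a chord with fixed right end [w] does not decrease as its
    left end moves right. *)
Lemma convex_slope_le (R : realType) (f : R -> R) (q u v w : R) :
  convex_function (`[0, +oo[%classic : set R^o) f ->
  0 <= u -> u <= v <= w -> q * (w - u) <= f w - f u ->
  q * (w - v) <= f w - f v.
Proof.
move=> cvx u0 /andP[uv vw] H.
have [uw|wu] := ltP u w; last first.
  by have -> : v = u by apply/eqP; rewrite eq_le uv andbT; lra.
have wu0 : 0 < w - u by lra.
pose t := (w - v) / (w - u).
have t0 : 0 <= t by rewrite divr_ge0; lra.
have t1 : t <= 1 by rewrite ler_pdivrMr//; lra.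
have uD : u \in (`[0, +oo[%classic : set R^o) by rewrite inE/= in_itv/= andbT.
have wD : w \in (`[0, +oo[%classic : set R^o).
  by rewrite inE/= in_itv/= andbT; lra.
have := cvx (Itv01 t0 t1) _ _ uD wD.
have -> : conv (Itv01 t0 t1) (u : convex_lmodType R^o) w = t * u + (1 - t) * w.
  by [].
have -> : conv (Itv01 t0 t1) (f u : R^o) (f w) = t * f u + (1 - t) * f w by [].
have tE : t * (w - u) = w - v by rewrite /t divfK// gt_eqF.
have -> : t * u + (1 - t) * w = v by lra.
have := ler_wpM2l t0 H; rewrite mulrCA tE; lra.
Qed.

(** * Optimality conditions of price-anticipating tenants *)

(** Here [r] is the price anticipated for the total bid. Parametrizing by [r] instead of the bid
    removes all square roots. *)
Lemma price_anticipating_payoffE (R : realType) (N : nat) (delta alpha r : R)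
    (c : 'I_N -> R -> R) (b : 'I_N -> R) (n : 'I_N) (x : R) :
  (0 < N)%N -> 0 < delta -> 0 < alpha -> 0 < r ->
  total_bid b n x = N%:R * delta / alpha * r ^+ 2 ->
  price_anticipating_payoff delta alpha c b n x
    = price_taking_payoff delta c r n x.
Proof.
move=> N0 d0 a0 r0 BE.
have n0 : 0 < N%:R :> R by rewrite ltr0n.
have k0 : 0 < Num.sqrt (N%:R * delta / alpha) by rewrite sqrtr_gt0 divr_gt0 ?mulr_gt0.
rewrite /price_anticipating_payoff /price_taking_payoff /supply BE.
have -> : N%:R * delta / alpha * r ^+ 2 * alpha * delta / N%:R = (r * delta) ^+ 2.
  by field; rewrite !gt_eqF.
rewrite sqrtr_sqr gtr0_norm ?mulr_gt0//.
rewrite sqrtrM ?divr_ge0 ?mulr_ge0 ?ltW// sqrtr_sqr gtr0_norm//.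
congr (_ - c n (_ - _)).
by field; rewrite !gt_eqF.
Qed.

(* Raising the bid so that the anticipated price goes from p to r > p must not
   pay off; clearing denominators leaves a quadratic inequality in r - p, whose
   constant term is the right-hand first-order condition. *)
Lemma anticipating_first_order (R : realType) (N : nat) (delta alpha p q u : R)
    (c : 'I_N -> R -> R) (b : 'I_N -> R) (n : 'I_N) :
  let s := delta - b n / p in
  (0 < N)%N -> 0 < delta -> 0 < alpha -> 0 < p -> 0 <= q ->
  (forall m, 0 <= b m) ->
  \sum_(m < N) b m = N%:R * delta / alpha * p ^+ 2 ->
  (forall x, 0 <= x -> 0 < total_bid b n (b n) -> 0 < total_bid b n x ->
     price_anticipating_payoff delta alpha c b n x
       <= price_anticipating_payoff delta alpha c b n (b n)) ->
  u < s ->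
  (forall s', u <= s' <= s -> q * (s - s') <= c n s - c n s') ->
  2 * (q - p) * (p - alpha / (2 * N%:R)) + q * s * alpha / (N%:R * delta) <= 0.
Proof.
move=> s N0 d0 a0 p0 q0 b0 BE opt us slope.
have sE : s = delta - b n / p by [].
clearbody s.
have n0 : 0 < N%:R :> R by rewrite ltr0n.
set K := N%:R * delta / alpha in BE.
have KE : K = N%:R * delta / alpha by [].
have K0 : 0 < K by rewrite divr_gt0 ?mulr_gt0.
clearbody K.
have TB x : total_bid b n x = x - b n + K * p ^+ 2.
  by rewrite /total_bid -BE [in RHS](bigD1 n)//= addrA subrK.
have bB : b n <= K * p ^+ 2.
  by rewrite -BE (bigD1 n)//= lerDl sumr_ge0.
set bn := b n in sE us slope TB bB opt *.
have bn0 : 0 <= bn by apply: b0.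
(* Raising the price by [t] lowers the supply by at most [2 * K * t], so [t <= e] keeps it above
   [u], where the slope bound holds. *)
pose e := (s - u) / (2 * K).
have e0 : 0 < e by rewrite divr_gt0 ?mulr_gt0//; lra.
suff : delta * p ^+ 2 - 2 * K * p ^+ 3 + q * (2 * K * p ^+ 2 - bn) <= 0.
  have -> : delta * p ^+ 2 - 2 * K * p ^+ 3 + q * (2 * K * p ^+ 2 - bn) =
    (2 * (q - p) * (p - alpha / (2 * N%:R)) + q * s * alpha / (N%:R * delta))
    * (K * p).
    by rewrite KE sE; field; rewrite !gt_eqF.
  by rewrite pmulr_lle0// mulr_gt0.
(* The coefficients come from expanding the bracket of [H3] below at [r = p + t]. *)
apply: (@quadratic_le0_at0 _ _
  (delta * p - 3 * K * p ^+ 2 + q * K * p) (- (K * p)) e) => // t /andP[t0 te].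
pose r := p + t.
have r0 : 0 < r by rewrite /r; lra.
pose x := bn + K * (r ^+ 2 - p ^+ 2).
have rp2 : 0 <= r ^+ 2 - p ^+ 2 by rewrite /r; nra.
have x0 : 0 <= x by rewrite /x addr_ge0// mulr_ge0// ltW.
have TBx : total_bid b n x = K * r ^+ 2 by rewrite TB /x; lra.
have TBb : total_bid b n bn = K * p ^+ 2 by rewrite TB; lra.
have := opt x x0.
rewrite {1}TBb {1}TBx !mulr_gt0 ?exprn_gt0// => /(_ isT isT).
rewrite (@price_anticipating_payoffE _ _ _ _ r) -?KE//.
rewrite (@price_anticipating_payoffE _ _ _ _ p) -?KE//.
rewrite /price_taking_payoff /supply -sE.
set s' := delta - x / r.
have dE : (s - s') * (r * p) = t * (K * (r + p) * p - bn).
  by rewrite sE /s' /x /r; field; rewrite !gt_eqF.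
have rp0 : 0 < r * p by rewrite mulr_gt0.
have kp : bn <= K * (r + p) * p.
  apply: (le_trans bB); rewrite expr2 mulrA ler_pM2r// ler_pM2l// /r; lra.
have s's : s' <= s.
  rewrite -subr_ge0 -(pmulr_lge0 _ rp0) dE mulr_ge0//; lra.
have us' : u <= s'.
  have : (s - s') * (r * p) <= (s - u) * (r * p).
    rewrite dE.
    have h1 : t * (2 * K) <= s - u by rewrite -ler_pdivlMr ?mulr_gt0.
    have h2 : K * (r + p) * p - bn <= 2 * K * (r * p).
      have : 0 <= K * p * t by rewrite !mulr_ge0// ltW.
      rewrite /r; lra.
    apply: (@le_trans _ _ (t * (2 * K * (r * p)))).
      by rewrite ler_pM2l.
    by rewrite (mulrA t) ler_pM2r.
  by rewrite ler_pM2r//; lra.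
have := slope s'; rewrite us' s's => /(_ isT) sl H.
have H1 : r * delta - x + q * (s - s') <= p * delta - bn by lra.
have H2 : (r * delta - x - p * delta + bn + q * (s - s')) * (r * p) <= 0.
  by rewrite pmulr_lle0//; lra.
have H3 : t * (delta * (r * p) - K * (r + p) * (r * p)
               + q * (K * (r + p) * p - bn)) <= 0.
  apply: le_trans H2; rewrite le_eqVlt; apply/orP; left; apply/eqP.
  rewrite [RHS]mulrDl -[q * _ * _]mulrA dE /x /r; ring.
rewrite pmulr_rle0// in H3.
apply: le_trans H3; rewrite le_eqVlt; apply/orP; left; apply/eqP.
rewrite /r; ring.
Qed.

(** The first-order condition is used twice. With [q = 0], where monotonicity suffices, it gives
    [p >= alpha / (2 N)]. With the given [q], its last term is positive because [s > 0], so [q >= p]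
    would make the left side positive. *)
Lemma anticipating_price_gt (R : realType) (N : nat) (delta alpha p q u : R)
    (c : 'I_N -> R -> R) (b : 'I_N -> R) (n : 'I_N) :
  let s := delta - b n / p in
  (0 < N)%N -> 0 < delta -> 0 < alpha -> 0 < p -> 0 < q ->
  (forall s, s <= 0 -> c n s = 0) ->
  convex_function (`[0, +oo[%classic : set R^o) (c n) ->
  (forall s t, 0 <= s -> s < t -> c n s < c n t) ->
  (forall m, 0 <= b m) ->
  \sum_(m < N) b m = N%:R * delta / alpha * p ^+ 2 ->
  (forall x, 0 <= x -> 0 < total_bid b n (b n) -> 0 < total_bid b n x ->
     price_anticipating_payoff delta alpha c b n x
       <= price_anticipating_payoff delta alpha c b n (b n)) ->
  0 <= u -> u < s -> q * (s - u) <= c n s - c n u -> q < p.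
Proof.
move=> s N0 d0 a0 p0 q0 cnp cvx cinc b0 BE opt u0 us slope.
have n0 : 0 < N%:R :> R by rewrite ltr0n.
have p_ge : 0 <= p - alpha / (2 * N%:R).
  have := @anticipating_first_order _ _ _ _ p 0 (s - 1) _ _ n N0 d0 a0 p0 (lexx _) b0 BE opt.
  rewrite -/s !mul0r addr0 sub0r mulrN mulNr oppr_le0 pmulr_rge0; last by lra.
  apply; first by rewrite ltrBlDr ltrDl.
  move=> s' /andP[_]; rewrite le_eqVlt => /predU1P[->|s's]; first by rewrite mul0r subrr.
  have c0s : 0 < c n s by rewrite -(cnp 0 (lexx _)) cinc//; lra.
  have [s'0|s'0] := lerP s' 0; first by rewrite (cnp s')// mul0r; lra.
  by rewrite mul0r subr_ge0 ltW// cinc// ltW.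
have := @anticipating_first_order _ _ _ _ p q u _ _ n N0 d0 a0 p0 (ltW q0) b0 BE opt us.
rewrite -/s => /(_ _) fo.
have {}fo : 2 * (q - p) * (p - alpha / (2 * N%:R)) + q * s * alpha / (N%:R * delta) <= 0.
  by apply: fo => s' us's; exact: (convex_slope_le _ _ _ u _ s cvx u0 us's slope).
have pos : 0 < q * s * alpha / (N%:R * delta).
  have s0 : 0 < s by lra.
  by rewrite divr_gt0// ?mulr_gt0.
rewrite ltNge; apply/negP => pq.
have : 0 <= 2 * (q - p) * (p - alpha / (2 * N%:R)).
  by rewrite !mulr_ge0//; lra.
lra.
Qed.

(** * The social optimum and its multiplier *)

(** The Lagrangian is affine in [y] with slope [alpha - p]; testing at 0 and [2 * y] forces this
    slope to vanish. *)
Lemma socially_optimal_priceE (R : realType) (N : nat) (delta alpha : R)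
    (c : 'I_N -> R -> R) (s : 'I_N -> R) (y p : R) :
  (forall i, 0 <= s i) -> 0 < y ->
  socially_optimal_price delta alpha c s y p -> p = alpha.
Proof.
move=> s0 y0 H.
have := H s 0 s0 (lexx _).
have := H s (2 * y) s0 _.
rewrite /social_lagrangian /social_cost => /(_ _) h1 h2.
have {}h1 := h1 ltac:(lra).
have {}h1 : 0 <= (alpha - p) * y by lra.
have {}h2 : (alpha - p) * y <= 0 by lra.
move: h1 h2; rewrite pmulr_lge0// pmulr_lle0//; lra.
Qed.

Lemma socially_optimal_slope (R : realType) (N : nat) (delta alpha : R)
    (c : 'I_N -> R -> R) (s : 'I_N -> R) (y p t : R) (n : 'I_N) :
  (forall i, 0 <= s i) -> 0 <= y ->
  socially_optimal_price delta alpha c s y p ->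
  0 <= t -> p * (t - s n) <= c n t - c n (s n).
Proof.
move=> s0 y0 H t0.
pose s' m := if m == n then t else s m.
have s'0 m : 0 <= s' m by rewrite /s'; case: ifP.
(* A general [f] serves both the cost and the balance constraint. *)
have E (f : 'I_N -> R -> R) :
    \sum_(i < N) f i (s' i) = \sum_(i < N) f i (s i) - f n (s n) + f n t.
  rewrite (bigD1 n)//= [in RHS](bigD1 n)//= /s' eqxx.
  under eq_bigr => i /negbTE -> do [].
  lra.
have := H s' y s'0 y0.
rewrite /social_lagrangian /social_cost (E c) (E (fun _ => id)); lra.
Qed.

(** * Optimality of price-taking tenants *)

(** The bid [p * (delta - t)] yields supply [t] and payoff [p * t - c n t], so bids may be traded
    for supplies [t <= delta]. A negative supply has zero cost and negative revenue, hence loses to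
    [t = 0]. *)
Lemma price_taking_supply (R : realType) (N : nat) (delta p : R)
    (c : 'I_N -> R -> R) (b : 'I_N -> R) (n : 'I_N) :
  let s := delta - b n / p in
  0 < delta -> 0 < p -> (forall s, s <= 0 -> c n s = 0) ->
  (forall x, 0 <= x ->
     price_taking_payoff delta c p n x <= price_taking_payoff delta c p n (b n)) ->
  0 <= s /\ forall t, t <= delta -> p * (t - s) <= c n t - c n s.
Proof.
move=> s d0 p0 cnp opt.
have sE : s = delta - b n / p by [].
clearbody s.
have slope t : t <= delta -> p * (t - s) <= c n t - c n s.
  move=> td; have x0 : 0 <= p * (delta - t) by rewrite mulr_ge0 ?subr_ge0// ltW.
  have := opt _ x0; rewrite /price_taking_payoff /supply -sE.
  have -> : delta - p * (delta - t) / p = t by field; rewrite gt_eqF.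
  have -> : b n = p * (delta - s) by rewrite sE; field; rewrite gt_eqF.
  lra.
split=> //; rewrite leNgt; apply/negP => sneg.
have := slope 0 (ltW d0); rewrite (cnp 0)// (cnp s (ltW sneg)).
have : 0 < p * - s by rewrite mulr_gt0// oppr_gt0.
lra.
Qed.

(** * Market clearing and the operator's choice of generation *)

Lemma sum_supply (R : realType) (N : nat) (delta p : R) (b : 'I_N -> R) :
  \sum_(n < N) (delta - b n / p) = N%:R * delta - (\sum_(n < N) b n) / p.
Proof. by rewrite sumrB sumr_const card_ord mulr_suml -[delta *+ N]mulr_natl. Qed.

Lemma exists_gt_of_sum_gt (R : realType) (N : nat) (f g : 'I_N -> R) :
  \sum_(n < N) g n < \sum_(n < N) f n -> exists n, g n < f n.
Proof.
move=> gf; apply: contrapT => /forallNP H.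
move: gf; apply/negP; rewrite -leNgt; apply: ler_sum => n _.
by rewrite leNgt; apply/negP.
Qed.

(** A finite positive price excludes the conventions for [D = 0]. Multiplied by the denominator at
    [z], the comparison of [y] with [z] factors as in [step]; moving [z] to either side of [y] gives
    the two inequalities. *)
Lemma clearing_operator_first_order (R : realType) (N : nat)
    (delta alpha : R) (b : 'I_N -> R) (p y : R) :
  let D := (N%:R - 1) * delta + y in
  (0 < N)%N -> 0 < delta -> 0 < p ->
  p%:E = clearing_price delta b y -> operator_optimal delta alpha b y ->
  [/\ 0 < D, \sum_(n < N) b n = p * D,
      y < delta -> N%:R * delta * p <= alpha * D &
      0 < y -> alpha * D <= N%:R * delta * p].
Proof.
move=> D N0 d0 p0 pE [/andP[y0 yd] opt].
have N1 : 0 <= (N%:R - 1) * delta.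
  by rewrite mulr_ge0 ?subr_ge0 ?ler1n// ltW.
have [D0 BE] : 0 < D /\ \sum_(n < N) b n = p * D.
  move: pE; rewrite /clearing_price -/D.
  case: eqVneq => [_|Dn0]; first by case: ifP => _ // [] E; move: p0; rewrite E ltxx.
  move=> [] E; split; last by rewrite E divfK.
  by rewrite lt_neqAle eq_sym Dn0 /D addr_ge0.
have step z : 0 < z <= delta ->
    (z - y) * (N%:R * delta * p - alpha * ((N%:R - 1) * delta + z)) <= 0.
  move=> /andP[z0 zd].
  have E0 : 0 < (N%:R - 1) * delta + z by rewrite ltr_wpDl.
  have := opt z; rewrite (ltW z0) zd => /(_ isT).
  rewrite /operator_objective -pE /clearing_price gt_eqF// BE.
  rewrite -!EFinM -!EFinD lee_fin.
  set E := (N%:R - 1) * delta + z in E0 *.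
  have zE : z = E - (N%:R - 1) * delta by rewrite /E; ring.
  have yE : y = D - (N%:R - 1) * delta by rewrite /D; ring.
  rewrite -(ler_pM2r E0) mulrDl -mulrA.
  have -> : ((delta - z) * (p * D / E) + alpha * z) * E =
    (delta - z) * (p * D) + alpha * z * E by field; rewrite gt_eqF.
  clearbody E D; subst y z; lra.
split=> // [yd'|y0'].
  rewrite -subr_le0; apply: (@quadratic_le0_at0 _ _ (- alpha) 0 (delta - y)).
    by rewrite subr_gt0.
  move=> t /andP[t0 tl]; rewrite -(pmulr_rle0 _ t0).
  have := step (y + t) ltac:(apply/andP; split; lra).
  by congr (_ <= _); rewrite /D; ring.
(* The bound [y / 2] keeps [y - t] positive, so its denominator cannot vanish even for [N = 1]. *)
rewrite -subr_le0; apply: (@quadratic_le0_at0 _ _ (- alpha) 0 (y / 2)); first by rewrite divr_gt0.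
move=> t /andP[t0 tl]; rewrite -(pmulr_rle0 _ t0).
have := step (y - t) ltac:(apply/andP; split; lra).
by congr (_ <= _); rewrite /D; ring.
Qed.

Lemma clearing_price_interior (R : realType) (N : nat)
    (delta alpha : R) (b : 'I_N -> R) (p y : R) :
  (0 < N)%N -> 0 < delta -> 0 < p -> 0 < y -> y < delta ->
  p%:E = clearing_price delta b y -> operator_optimal delta alpha b y ->
  N%:R * delta * p = alpha * ((N%:R - 1) * delta + y).
Proof.
move=> N0 d0 p0 y0 yd pE opt.
have [_ _ h1 h2] := clearing_operator_first_order _ _ _ alpha _ _ _ N0 d0 p0 pE opt.
by apply/eqP; rewrite eq_le h1// h2.
Qed.

Lemma cost_o_at_optimum (R : realType) (N : nat)
    (delta alpha : R) (b : 'I_N -> R) (p y : R) :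
  (0 < N)%N -> 0 < delta -> 0 < p -> 0 < y ->
  p%:E = clearing_price delta b y -> operator_optimal delta alpha b y ->
  cost_o delta alpha p y
    = alpha * delta - alpha * (delta - y) ^+ 2 / (N%:R * delta).
Proof.
move=> N0 d0 p0 y0 pE opt.
have n0 : 0 < N%:R :> R by rewrite ltr0n.
have [/andP[_ yd] _] := opt.
(* At [y = delta] the first-order condition is one-sided, but the price is multiplied by 0. *)
rewrite /cost_o; move: (yd); rewrite le_eqVlt => /predU1P[->|yd'].
  by rewrite subrr expr0n/= !(mulr0, mul0r) subr0 add0r.
have pD := clearing_price_interior _ _ _ alpha _ _ _ N0 d0 p0 y0 yd' pE opt.
have -> : p = alpha * ((N%:R - 1) * delta + y) / (N%:R * delta).
  by rewrite -pD; field; rewrite !gt_eqF.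
by field; rewrite !gt_eqF.
Qed.

Lemma sum_supply_clearing (R : realType) (N : nat) (delta p y : R)
    (b : 'I_N -> R) :
  0 < p -> \sum_(n < N) b n = p * ((N%:R - 1) * delta + y) ->
  \sum_(n < N) (delta - b n / p) = delta - y.
Proof. by move=> p0 BE; rewrite sum_supply BE; field; rewrite gt_eqF. Qed.

(** * Comparison of the equilibria with the social optimum *)

Theorem theorem12 (R : realType) (N : nat) (delta alpha : R)
    (c : 'I_N -> R -> R)
    (hN : (1 <= N)%N) (hdelta : 0 < delta) (halpha : 0 < alpha)
    (c_cont : forall n : 'I_N, continuous (c n))
    (c_nonpos : forall (n : 'I_N) (s : R), s <= 0 -> c n s = 0)
    (c_convex : forall n : 'I_N,
       convex_function (`[0, +oo[%classic : set R^o) (c n))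
    (c_incr : forall (n : 'I_N) (s t : R), 0 <= s -> s < t -> c n s < c n t)
    (c_deriv : forall n : 'I_N,
       alpha / (2 * N%:R) <= right_derivative (c n) 0)
    (sstar : 'I_N -> R) (ystar pstar : R)
    (hopt : social_optimum delta alpha c sstar ystar)
    (hystar : 0 < ystar)
    (hpstar : socially_optimal_price delta alpha c sstar ystar pstar)
    (bt : 'I_N -> R) (pt yt : R)
    (ht : price_taking_equilibrium delta alpha c bt pt yt)
    (ba : 'I_N -> R) (pa ya : R)
    (ha : price_anticipating_equilibrium delta alpha c ba pa ya) :
  (cost_o delta alpha pstar ystar - alpha * delta / N%:R
     <= cost_o delta alpha pa ya <= cost_o delta alpha pstar ystar) /\
  (cost_o delta alpha pa ya - alpha * delta / N%:R
     <= cost_o delta alpha pt yt <= cost_o delta alpha pa ya).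
Proof.
have n0 : 0 < N%:R :> R by rewrite ltr0n.
have nd0 : 0 < N%:R * delta by rewrite mulr_gt0.
have [[sum_sstar sstar0 _] _] := hopt.
have pstarE := socially_optimal_priceE _ _ _ _ _ _ _ _ sstar0 hystar hpstar.
subst pstar.
have star_slope n t : 0 <= t ->
    alpha * (t - sstar n) <= c n t - c n (sstar n).
  exact: (socially_optimal_slope _ _ _ _ _ _ _ _ _ _ sstar0 (ltW hystar) hpstar).
have [[bt0 pt0] taking ptE opt_t] := ht.
have [Dt0 BtE foc_t foc_t'] :=
  clearing_operator_first_order _ _ _ alpha _ _ _ hN hdelta pt0 ptE opt_t.
have [/andP[yt_ge0 yt_le] _] := opt_t.
have sum_t := sum_supply_clearing _ _ _ _ _ _ pt0 BtE.
have supply_t n := price_taking_supply _ _ _ _ _ _ n hdelta pt0 (c_nonpos n) (taking n).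
have [[ba0 pa0] anticipating paE opt_a] := ha.
have [Da0 BaE foc_a foc_a'] :=
  clearing_operator_first_order _ _ _ alpha _ _ _ hN hdelta pa0 paE opt_a.
have [/andP[ya_ge0 ya_le] _] := opt_a.
(* If [yt = 0], then [pt < alpha] and some tenant supplies more than in the optimum; adding its two
   slope inequalities, at prices [alpha] and [pt], is contradictory. *)
have yt0 : 0 < yt.
  rewrite lt_neqAle yt_ge0 andbT; apply/eqP => yt0; subst yt.
  have pt_lt : pt < alpha.
    rewrite -(ltr_pM2l nd0); apply: (le_lt_trans (foc_t hdelta)).
    by rewrite addr0 mulrC ltr_pM2r// ltr_pM2r// gtrBl.
  have [|n sn] := @exists_gt_of_sum_gt _ _ (fun n => delta - bt n / pt) sstar.
    by rewrite sum_t; lra.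
  have [_ slope] := supply_t n.
  have bp : 0 <= bt n / pt by rewrite divr_ge0 ?bt0 ?ltW.
  have h1 := star_slope n (delta - bt n / pt) ltac:(apply: (le_trans (sstar0 n)); exact: ltW).
  have h2 := slope (sstar n) ltac:(lra).
  have : 0 < (alpha - pt) * (delta - bt n / pt - sstar n).
    by rewrite mulr_gt0// subr_gt0.
  lra.
(* The price [p] stays free: it need not be [pa] when [ya = 0]. *)
have anticipated_price_gt n p q u :
    0 < p -> \sum_(m < N) ba m = N%:R * delta / alpha * p ^+ 2 ->
    0 < q -> 0 <= u -> u < delta - ba n / p ->
    q * (delta - ba n / p - u) <= c n (delta - ba n / p) - c n u -> q < p.
  move=> p0 BE q0 u0 us; apply: (anticipating_price_gt _ N delta alpha p q u c ba n) => //.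
  - exact: c_nonpos.
  - exact: c_incr.
  - exact: anticipating.
have ya0 : 0 < ya.
  rewrite lt_neqAle ya_ge0 andbT; apply/eqP => ya0; subst ya.
  (* The price that the tenants anticipate; a priori it differs from pa when ya = 0. *)
  pose p := Num.sqrt ((\sum_(m < N) ba m) * alpha / (N%:R * delta)).
  have Ba0 : 0 < \sum_(m < N) ba m by rewrite BaE mulr_gt0.
  have p0 : 0 < p by rewrite sqrtr_gt0 divr_gt0 ?mulr_gt0.
  have p2 : p ^+ 2 = (\sum_(m < N) ba m) * alpha / (N%:R * delta).
    by rewrite sqr_sqrtr// divr_ge0 ?mulr_ge0 ?ltW.
  have BE : \sum_(m < N) ba m = N%:R * delta / alpha * p ^+ 2.
    by rewrite p2; field; rewrite !gt_eqF.
  (* With [ya = 0], [(N p)^2 = N pa alpha (N - 1)], and [foc_a] bounds [N pa] by [alpha (N - 1)]. *)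
  have p_le : N%:R * p <= alpha * (N%:R - 1).
    rewrite -ler_sqr ?nnegrE; first last.
    - by rewrite mulr_ge0 ?subr_ge0 ?ler1n// ltW.
    - by rewrite mulr_ge0 ?ltW.
    have -> : (N%:R * p) ^+ 2 = N%:R * delta * pa * (alpha * (N%:R - 1)) / delta.
      by rewrite exprMn p2 BaE; field; rewrite !gt_eqF.
    rewrite ler_pdivrMr//.
    have -> : (alpha * (N%:R - 1)) ^+ 2 * delta =
      alpha * ((N%:R - 1) * delta + 0) * (alpha * (N%:R - 1)) by ring.
    by rewrite ler_wpM2r ?foc_a// mulr_ge0 ?subr_ge0 ?ler1n// ltW.
  have p_lt : p < alpha.
    by rewrite -(ltr_pM2l n0); apply: (le_lt_trans p_le); lra.
  (* Supplies at [p] need not sum to [delta], but [p_le] makes their sum at least [delta]. *)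
  have [|n sn] := @exists_gt_of_sum_gt _ _ (fun n => delta - ba n / p) sstar.
    rewrite sum_supply BE.
    have -> : N%:R * delta - N%:R * delta / alpha * p ^+ 2 / p =
      delta + delta * (alpha * (N%:R - 1) - N%:R * p) / alpha.
      by field; rewrite !gt_eqF.
    apply: (@lt_le_trans _ _ delta); first by lra.
    by rewrite lerDl divr_ge0 ?mulr_ge0 ?subr_ge0// ?ltW.
  have := anticipated_price_gt n p alpha _ p0 BE halpha (sstar0 n) sn.
  rewrite star_slope; last by apply: (le_trans (sstar0 n)); exact: ltW.
  by move=> /(_ isT); lra.
(* If [ya < yt], then [ya] is interior and the anticipated price is [pa]. A tenant supplying more
   when anticipating gives [pt < pa], whereas the operator's conditions give [pa < pt]. *)
have ya_ge : yt <= ya.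
  rewrite leNgt; apply/negP => ya_lt.
  have paD := clearing_price_interior _ _ _ alpha _ _ _ hN hdelta pa0 ya0
    (lt_le_trans ya_lt yt_le) paE opt_a.
  have BE : \sum_(m < N) ba m = N%:R * delta / alpha * pa ^+ 2.
    have -> : N%:R * delta / alpha * pa ^+ 2 = N%:R * delta * pa * pa / alpha.
      by field; rewrite !gt_eqF.
    by rewrite BaE paD; field; rewrite !gt_eqF.
  have [|n sn] := @exists_gt_of_sum_gt _ _
      (fun n => delta - ba n / pa) (fun n => delta - bt n / pt).
    by rewrite sum_t (sum_supply_clearing _ _ _ _ _ _ pa0 BaE); lra.
  have [st0 slope] := supply_t n.
  have bp : 0 <= ba n / pa by rewrite divr_ge0 ?ba0 ?ltW.
  have sa_le : delta - ba n / pa <= delta by rewrite gerBl.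
  have pt_pa := anticipated_price_gt n pa pt _ pa0 BE pt0 st0 sn (slope _ sa_le).
  have : N%:R * delta * pt < N%:R * delta * pa by rewrite ltr_pM2l.
  have : alpha * ((N%:R - 1) * delta + ya) < alpha * ((N%:R - 1) * delta + yt).
    by rewrite ltr_pM2l// ltrD2l.
  rewrite -paD; have := foc_t' yt0; lra.
rewrite (cost_o_at_optimum _ _ _ alpha _ _ _ hN hdelta pt0 yt0 ptE opt_t).
rewrite (cost_o_at_optimum _ _ _ alpha _ _ _ hN hdelta pa0 ya0 paE opt_a).
have -> : cost_o delta alpha alpha ystar = alpha * delta by rewrite /cost_o; ring.
(* The equilibrium costs are [alpha * delta] minus a loss in [[0, alpha * delta / N]] that decreases
   with generation. *)
have loss_le z : 0 < z -> z <= delta ->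
    alpha * (delta - z) ^+ 2 / (N%:R * delta) <= alpha * delta / N%:R.
  move=> z0 zd; have -> : alpha * delta / N%:R = alpha * delta ^+ 2 / (N%:R * delta).
    by field; rewrite !gt_eqF.
  by rewrite ler_pM2r ?invr_gt0// ler_pM2l// ler_sqr ?nnegrE; lra.
have loss_ge0 z : 0 <= alpha * (delta - z) ^+ 2 / (N%:R * delta).
  by rewrite divr_ge0 ?(ltW nd0)// mulr_ge0 ?sqr_ge0// ltW.
have loss_anti : alpha * (delta - ya) ^+ 2 / (N%:R * delta)
    <= alpha * (delta - yt) ^+ 2 / (N%:R * delta).
  by rewrite ler_pM2r ?invr_gt0// ler_pM2l// ler_sqr ?nnegrE; lra.
have := loss_le _ yt0 yt_le; have := loss_le _ ya0 ya_le.
have := loss_ge0 ya; have := loss_ge0 yt.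
by split; apply/andP; split; lra.
Qed.
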